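(* Let $G$ be a finite simple graph on $[n]$ and let $K$ be a field with $\operatorname{char}(K)\neq 2$. Then, with respect to the lexicographic order on $K[x_1,\ldots,x_n,y_1,\ldots,y_n]$ induced by $x_1>\cdots>x_n>y_1>\cdots>y_n$, the following elements form a Gröbner basis of the ideal $\Pi_G$: (i) $u_{\pi_{ij}}b_{ij}$, where $\pi_{ij}$ is an odd admissible path and $b_{ij}=x_iy_j+x_jy_i$; (ii) $u_{\pi_{ij}}g_{ij}$, where $\pi_{ij}$ is an even admissible path and $g_{ij}=x_iy_j-x_jy_i$; (iii) $\operatorname{lcm}(u_{\pi_{ij}},u_{\sigma_{ij}})\,y_ix_j$, where $\pi_{ij}$ is an odd and $\sigma_{ij}$ is an even admissible path (both from $i$ to $j$); (iv) $y_b\prod_{h\in W}x_h$ if $b<h$ for every $h\in W$, and $x_b\prod_{h\in W}y_h$ if $b>h$ for every $h\in W$, where $W=(V(\pi_{ij})\cup V(\sigma_{ij})\cup V(\tau_{ab}))\setminus\{b\}$, $\pi_{ij}$ is an odd and $\sigma_{ij}$ is an even admissible path from $i$ to $j$, and $\tau_{ab}$ is a path in $G$ with endpoints $a$ and $b$ such that $a$ is the only vertex of $\tau_{ab}$ that belongs to $V(\pi_{ij})\cup V(\sigma_{ij})$. Here all paths are paths in $G$, and in each item the paths range over all choices satisfying the stated conditions.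
   Context: $\Pi_G=(x_iy_j+x_jy_i:\{i,j\}\in E(G))\subset K[x_1,\ldots,x_n,y_1,\ldots,y_n]$ is the permanental edge ideal of $G$. For distinct vertices $i,j$ of $G$, a path of length $r$ from $i$ to $j$ is a sequence $\pi_{ij}: i=i_0,i_1,\ldots,i_r=j$ of pairwise distinct vertices with $\{i_k,i_{k+1}\}\in E(G)$ for all $k$; $V(\pi_{ij})$ is its set of vertices. A path is even (odd) if its length is even (odd). The path $\pi_{ij}$ is admissible if $i<j$ and for each $k=1,\ldots,r-1$ one has either $i_k<i$ or $i_k>j$. For an admissible path $\pi_{ij}$ put $u_{\pi_{ij}}=\prod_{i_k>j}x_{i_k}\prod_{i_k<i}y_{i_k}$. *)

(* Defs.v *)
From mathcomp Require Import all_boot all_order all_algebra.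
From mathcomp Require Export mpoly.

Set Implicit Arguments.
Unset Strict Implicit.
Unset Printing Implicit Defensive.

Import GRing.Theory.
Local Open Scope ring_scope.

Section Ideals.

Variable R : comNzRingType.

Definition ideal_gen (S : R -> Prop) (f : R) : Prop :=
  exists (k : nat) (c s : 'I_k -> R),
    (forall i, S (s i)) /\ f = \sum_(i < k) c i * s i.

End Ideals.

Section Groebner.

Variables (m : nat) (K : fieldType).

(* The default order of mpoly compares total degrees first; this is the pure
   lexicographic order with 'X_0 > 'X_1 > ... > 'X_(m-1). *)
Definition lex_le (u v : 'X_{1..m}) : bool :=
  ((u : m.-tuplelexi nat) <= (v : m.-tuplelexi nat))%O.

Variable ord : rel 'X_{1..m}.

(* Only nonzero polynomials have a leading monomial. *)
Definition is_lead (f : {mpoly K[m]}) (u : 'X_{1..m}) : Prop :=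
  u \in msupp f /\ (forall v, v \in msupp f -> ord v u).

Definition initial_ideal (S : {mpoly K[m]} -> Prop) : {mpoly K[m]} -> Prop :=
  ideal_gen (fun t => exists f u, [/\ S f, is_lead f u & t = 'X_[u]]).

Definition groebner_basis (S I : {mpoly K[m]} -> Prop) : Prop :=
  [/\ exists s : seq {mpoly K[m]}, forall f, S f <-> f \in s,
      forall f, S f -> I f
    & forall t, initial_ideal S t <-> initial_ideal I t].

End Groebner.

Section PermanentalEdgeIdeal.

(* The graph has vertex set 'I_n and adjacency relation e.  In 'I_(n + n), the
   first n indices are those of the x_i and the last n those of the y_i, so that
   lex_le is induced by x_1 > ... > x_n > y_1 > ... > y_n. *)
Variables (n : nat) (K : fieldType) (e : rel 'I_n).

Definition xvar (i : 'I_n) : 'I_(n + n) := lshift n i.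
Definition yvar (i : 'I_n) : 'I_(n + n) := rshift n i.

Definition x_ (i : 'I_n) : {mpoly K[n + n]} := 'X_(xvar i).
Definition y_ (i : 'I_n) : {mpoly K[n + n]} := 'X_(yvar i).

Definition b_ (i j : 'I_n) : {mpoly K[n + n]} := x_ i * y_ j + x_ j * y_ i.
Definition g_ (i j : 'I_n) : {mpoly K[n + n]} := x_ i * y_ j - x_ j * y_ i.

Definition perm_edge_ideal : {mpoly K[n + n]} -> Prop :=
  ideal_gen (fun f => exists i j, e i j /\ f = b_ i j).

(* The path i = i_0, i_1, ..., i_r = j is represented by its origin i and the
   sequence p = [:: i_1; ...; i_r], so that its length is size p. *)
Definition is_path (i j : 'I_n) (p : seq 'I_n) : bool :=
  [&& i != j, path e i p, last i p == j & uniq (i :: p)].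

Definition verts (i : 'I_n) (p : seq 'I_n) : {set 'I_n} := [set k in i :: p].

(* behead (belast i p) is the sequence i_1, ..., i_(r-1) of inner vertices. *)
Definition admissible (i j : 'I_n) (p : seq 'I_n) : bool :=
  [&& is_path i j p, (i < j)%N
    & all (fun k : 'I_n => (k < i)%N || (j < k)%N) (behead (belast i p))].

Definition odd_adm (i j : 'I_n) (p : seq 'I_n) : bool :=
  admissible i j p && odd (size p).

Definition even_adm (i j : 'I_n) (p : seq 'I_n) : bool :=
  admissible i j p && ~~ odd (size p).

(* The exponent vector of u_pi. *)
Definition u_ (i j : 'I_n) (p : seq 'I_n) : 'X_{1..n + n} :=
  (\sum_(k in verts i p | (j < k)%N) U_(xvar k)
   + \sum_(k in verts i p | (k < i)%N) U_(yvar k))%MM.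

(* The set W for pi = i :: p, sigma = i :: q and tau = a :: t; the endpoint of
   tau other than a is called c, since b_ is taken. *)
Definition W_ (i : 'I_n) (p q : seq 'I_n) (a : 'I_n) (t : seq 'I_n) (c : 'I_n) :
  {set 'I_n} := (verts i p :|: verts i q :|: verts a t) :\ c.

(* tau = a :: t is a path from a to c that meets V(pi) \cup V(sigma) only in a. *)
Definition tail_path (i : 'I_n) (p q : seq 'I_n) (a c : 'I_n) (t : seq 'I_n) :
  bool :=
  is_path a c t && (verts a t :&: (verts i p :|: verts i q) == [set a]).

Inductive perm_edge_gb : {mpoly K[n + n]} -> Prop :=
| gb_odd i j p : odd_adm i j p -> perm_edge_gb ('X_[u_ i j p] * b_ i j)
| gb_even i j p : even_adm i j p -> perm_edge_gb ('X_[u_ i j p] * g_ i j)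
| gb_lcm i j p q : odd_adm i j p -> even_adm i j q ->
    perm_edge_gb ('X_[mlcm (u_ i j p) (u_ i j q)] * (y_ i * x_ j))
| gb_low i j p q a c t : odd_adm i j p -> even_adm i j q ->
    tail_path i p q a c t ->
    (forall h, h \in W_ i p q a t c -> (c < h)%N) ->
    perm_edge_gb (y_ c * \prod_(h in W_ i p q a t c) x_ h)
| gb_high i j p q a c t : odd_adm i j p -> even_adm i j q ->
    tail_path i p q a c t ->
    (forall h, h \in W_ i p q a t c -> (h < c)%N) ->
    perm_edge_gb (x_ c * \prod_(h in W_ i p q a t c) y_ h).

End PermanentalEdgeIdeal.

(* Main.v *)
Require Import Defs.
From mathcomp Require Import all_boot all_order all_algebra.
From mathcomp Require Import ring zify.

(** The proof avoids Buchberger's criterion: it determines which monomials can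
    be leading monomials of elements of the ideal Pi_G.

    Modulo Pi_G, a monomial changes only by its sign when, for an edge ij, a
    factor x_i y_j is replaced by x_j y_i.  Think of each factor y_k as a token
    on the vertex k, with deg x_k + deg y_k the capacity of k: a token moves
    along edges between the vertices that occur in the monomial m, so the
    number of tokens in each connected component of the graph G_m induced on
    these vertices is invariant.  In a component with a proper 2-colouring, the
    parity of the number of tokens of one colour records the sign; in a
    component with an odd cycle, moving tokens around the cycle gives
    2 m = 0, hence m in Pi_G, as soon as both an x and a y occur there.

    Consequently m can only be a standard monomial if, in each component of
    G_m, the y's sit on the smallest possible vertices (no x_i y_j with i < j),
    and if each component with an odd closed walk carries only x's or only
    y's.  Conversely, such an m is the least monomial of its class, and the
    linear form that sends a monomial to its sign if it belongs to the class of
    m and to 0 otherwise kills Pi_G but not m: so m is not a leading monomial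
    of Pi_G (standard_not_lead).

    It remains to see that every other m is divisible by the leading monomial
    of a listed element.
    - If x_i y_j divides m with i < j in one component, a shortest path between
      such a pair is admissible and u_pi divides m: elements (i) and (ii)
      suffice, whatever the parity (inversion_divides).
    - Otherwise take an odd cycle in the bad component.  Between two vertices
      of the cycle that are consecutive in the order of the labels, both arcs
      are admissible, and exactly one of them is odd.  If the cycle carries
      both letters, two consecutive vertices carry y_i and x_j, and (iii)
      applies.  If it carries one letter, a path to the nearest vertex with
      the other letter gives (iv) (odd_component_divides).

    That the listed elements lie in Pi_G is an induction along paths
    (path_binomial_mem) for (i)-(iii), and moving one token around the two
    paths (marked_mem) for (iv); both (iii) and (iv) need 2 to be
    invertible. *)

Local Open Scope ring_scope.

(** * Ideals generated by a set *)

Section IdealTheory.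

Set Implicit Arguments.
Unset Strict Implicit.
Import GRing.Theory.

Variables (R : comNzRingType) (S : R -> Prop).
Local Notation J := (ideal_gen S).

Lemma ideal_gen_mem f : S f -> J f.
Proof.
move=> Sf; exists 1%N, (fun=> 1), (fun=> f); split=> //.
by rewrite big_ord1 mul1r.
Qed.

Lemma ideal_gen0 : J 0.
Proof.
by exists 0%N, (fun=> 0), (fun=> 0); split=> [[]|] //; rewrite big_ord0.
Qed.

Lemma ideal_genM a f : J f -> J (a * f).
Proof.
case=> [k [c [s [Ss ->]]]]; exists k, (fun i => a * c i), s; split=> //.
by rewrite mulr_sumr; apply: eq_bigr => i _; rewrite mulrA.
Qed.

Lemma ideal_genD f g : J f -> J g -> J (f + g).
Proof.
case=> [k [c [s [Ss ->]]]] [l [d [t [St ->]]]].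
pose glue (T : Type) (u : 'I_k -> T) (v : 'I_l -> T) i :=
  match split i with inl a => u a | inr b => v b end.
exists (k + l)%N, (glue _ c d), (glue _ s t); split=> [i|].
  by rewrite /glue; case: (split i).
rewrite big_split_ord /=; congr (_ + _); apply: eq_bigr => i _.
  by rewrite /glue (unsplitK (inl i)).
by rewrite /glue (unsplitK (inr i)).
Qed.

Lemma ideal_gen_combination a b f g : J f -> J g -> J (a * f + b * g).
Proof. by move=> Jf Jg; apply: ideal_genD; apply: ideal_genM. Qed.

End IdealTheory.

Lemma ideal_gen_sub (R : comNzRingType) (S T : R -> Prop) :
  (forall f, S f -> ideal_gen T f) -> forall f, ideal_gen S f -> ideal_gen T f.
Proof.
move=> sub f [k [c [s [Ss ->]]]].
elim/big_rec: _ => [|i g _ Tg]; first exact: ideal_gen0.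
by apply: ideal_genD => //; apply: ideal_genM; apply: sub.
Qed.

(** * Consequences of the relations X_i Y_j + X_j Y_i = 0 along walks *)

(** The families X and Y are abstract because the relations are symmetric
    under the exchange of x and y, and the elements of kind (iv) come in two
    exchanged forms. *)
Section PermanentalRelations.

Set Implicit Arguments.
Unset Strict Implicit.
Import GRing.Theory.

Variables (R : comNzRingType) (S : R -> Prop) (T : finType) (e : rel T).
Variables X Y : T -> R.
Local Notation J := (ideal_gen S).
Hypothesis edge_relation : forall i j, e i j -> J (X i * Y j + X j * Y i).

(** For two edges ik and kj, multiplying by X_k or by Y_k lets the middle vertex
    be eliminated, at the cost of one sign; hence the sign depends on the length
    of the path only, and either letter may be chosen at each inner vertex.
    Here s lists the inner vertices, so the path has length size s + 1. *)
Lemma path_binomial_mem (f : T -> bool) i j s : path e i (rcons s j) ->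
  J (\prod_(k <- s) (if f k then X k else Y k)
     * (X i * Y j + (-1) ^+ size s * (X j * Y i))).
Proof.
elim: s i => [|k s IHs] i /=.
  by rewrite andbT => eij; rewrite big_nil !mul1r; apply: edge_relation.
case/andP=> eik /IHs IH; rewrite big_cons exprS.
set u := \prod_(_ <- s) _ in IH *; set t := (-1) ^+ size s in IH *.
case: (f k).
  have -> : X k * u * (X i * Y j + -1 * t * (X j * Y i))
     = X i * (u * (X k * Y j + t * (X j * Y k)))
       + (- t * u * X j) * (X i * Y k + X k * Y i) by ring.
  by apply: ideal_gen_combination => //; apply: edge_relation.
have -> : Y k * u * (X i * Y j + -1 * t * (X j * Y i))
     = (u * Y j) * (X i * Y k + X k * Y i)
       + (- Y i) * (u * (X k * Y j + t * (X j * Y k))) by ring.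
by apply: ideal_gen_combination => //; apply: edge_relation.
Qed.

(** The squarefree monomial on V with its only token Y at h. *)
Definition marked (V : {set T}) h := Y h * \prod_(k in V :\ h) X k.

Lemma marked_edge (V : {set T}) h k :
  e h k -> h != k -> h \in V -> k \in V -> J (marked V h + marked V k).
Proof.
move=> ehk hk hV kV; rewrite /marked (big_setD1 k) /=; last first.
  by rewrite !inE eq_sym hk.
rewrite (big_setD1 (A := V :\ k) h) /=; last by rewrite !inE hk.
have -> : (V :\ h) :\ k = (V :\ k) :\ h.
  by apply/setP=> z; rewrite !inE; case: eqP; case: eqP.
set u := \prod_(_ in _) _.
have -> : Y h * (X k * u) + Y k * (X h * u) = u * (X h * Y k + X k * Y h).
  by ring.
by apply: ideal_genM; apply: edge_relation.
Qed.

Hypothesis e_irr : irreflexive e.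

Lemma marked_walk (V : {set T}) h p :
  path e h p -> h \in V -> {subset p <= V} ->
  J (marked V h - (-1) ^+ size p * marked V (last h p)).
Proof.
elim: p h => [|k p IHp] h /=.
  by move=> _ _ _; rewrite expr0 mul1r subrr; apply: ideal_gen0.
case/andP=> ehk pk hV sub; have kV : k \in V by apply: sub; rewrite mem_head.
have {}IHp : J (marked V k - (-1) ^+ size p * marked V (last k p)).
  by apply: IHp => // z zp; apply: sub; rewrite inE zp orbT.
have hk : h != k by apply: contraTneq ehk => ->; rewrite e_irr.
have := ideal_gen_combination 1 (-1) (marked_edge ehk hk hV kV) IHp.
by congr ideal_gen; rewrite exprS; ring.
Qed.

(** The token reaches the end of p with opposite signs along p and along q, so
    twice the monomial vanishes; the walk r brings the token from a to the
    origin of these two walks. *)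
Lemma marked_mem (half : R) (V : {set T}) i p q a r :
  half * 2%:R = 1 ->
  path e i p -> path e i q -> last i p = last i q -> odd (size p) ->
  ~~ odd (size q) -> i \in V -> {subset p <= V} -> {subset q <= V} ->
  path e a r -> last a r = i -> a \in V -> {subset r <= V} ->
  J (marked V a).
Proof.
move=> half2 pp pq pqE op oq iV pV qV pr rE aV rV.
have Jp := marked_walk pp iV pV; have Jq := marked_walk pq iV qV.
rewrite -signr_odd op expr1 pqE in Jp.
rewrite -signr_odd (negbTE oq) expr0 in Jq.
have Ji : J (marked V i).
  have := ideal_gen_combination half half Jp Jq; congr ideal_gen.
  set Mi := marked V i; set Mj := marked V _.
  have -> : half * (Mi - -1 * Mj) + half * (Mi - 1 * Mj) = (half * 2%:R) * Mi.
    by ring.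
  by rewrite half2 mul1r.
have := ideal_gen_combination 1 ((-1) ^+ size r) (marked_walk pr aV rV) Ji.
by rewrite rE; congr ideal_gen; ring.
Qed.

End PermanentalRelations.

(** * Monomials and the lexicographic order *)

Section Monomials.

Set Implicit Arguments.
Unset Strict Implicit.
Import GRing.Theory.

Lemma lex_le_first_diff m (u v : 'X_{1..m}) (t : 'I_m) :
  (forall i : 'I_m, (i < t)%N -> u i = v i) -> (u t < v t)%N -> lex_le u v.
Proof.
move=> eq_lt lt_t; apply: Order.POrderTheory.ltW; apply/ltxi_tuplePlt.
by exists t => // i /eq_lt; rewrite !multinomE.
Qed.

Lemma lex_le_cases m (u v : 'X_{1..m}) : lex_le u v ->
  u = v \/ exists2 t : 'I_m,
    forall i : 'I_m, (i < t)%N -> u i = v i & (u t < v t)%N.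
Proof.
rewrite /lex_le Order.POrderTheory.le_eqVlt; case/orP=> [/eqP /= uv|].
  by left; apply/val_inj.
by case/ltxi_tuplePlt=> t eq_lt lt_t; right; exists t.
Qed.

Lemma lex_le_refl m (u : 'X_{1..m}) : lex_le u u.
Proof. exact: Order.POrderTheory.lexx. Qed.

Lemma is_lead_monomial m (K : fieldType) (u : 'X_{1..m}) :
  is_lead (@lex_le m) ('X_[u] : {mpoly K[m]}) u.
Proof.
split=> [|v]; first by rewrite msuppX mem_head.
by rewrite msuppX inE => /eqP ->; apply: lex_le_refl.
Qed.

Lemma is_lead_binomial m (K : fieldType) (u v : 'X_{1..m}) (c : K) :
  u != v -> lex_le v u ->
  is_lead (@lex_le m) ('X_[u] + c *: 'X_[v] : {mpoly K[m]}) u.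
Proof.
move=> uv vu; split=> [|w].
  by rewrite mcoeff_msupp mcoeffD mcoeffZ !mcoeffX eqxx [v == u]eq_sym
    (negbTE uv) mulr0 addr0 oner_eq0.
rewrite mcoeff_msupp mcoeffD mcoeffZ !mcoeffX.
case: (eqVneq u w) => [<- _|_]; first exact: lex_le_refl.
by case: (eqVneq v w) => [<-|_] //; rewrite mulr0 addr0 eqxx.
Qed.

Variables (n : nat) (K : fieldType).
Implicit Types (i j k : 'I_n) (w : 'X_{1..n + n}).

Lemma xvar_eq i j : (xvar i == xvar j) = (i == j).
Proof. by rewrite (inj_eq (@lshift_inj _ _)). Qed.

Lemma yvar_eq i j : (yvar i == yvar j) = (i == j).
Proof. by rewrite (inj_eq (@rshift_inj _ _)). Qed.

Lemma xvar_yvar i j : (xvar i == yvar j) = false.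
Proof. exact: eq_lrshift. Qed.

Lemma yvar_xvar i j : (yvar i == xvar j) = false.
Proof. exact: eq_rlshift. Qed.

Definition var_eqE := (xvar_eq, yvar_eq, xvar_yvar, yvar_xvar).

Lemma var_cases (t : 'I_(n + n)) : exists i, t = xvar i \/ t = yvar i.
Proof.
by rewrite -(splitK t); case: (split t) => i; exists i; [left|right].
Qed.

Lemma mnm_var_lepP w w' :
  (forall i, (w (xvar i) <= w' (xvar i))%N) ->
  (forall i, (w (yvar i) <= w' (yvar i))%N) -> (w <= w')%MM.
Proof.
by move=> ex ey; apply/mnm_lepP=> t; have [i [|] ->] := var_cases t.
Qed.

Lemma sum_varE (P : pred 'I_n) (v : 'I_n -> 'I_(n + n)) t : injective v ->
  (\sum_(k | P k) U_(v k))%MM (v t) = P t.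
Proof.
move=> injv; rewrite mnm_sumE; case: (boolP (P t)) => Pt.
  rewrite (bigD1 t) //= mnm1E eqxx big1 // => k /andP[_ kt].
  by rewrite mnm1E (inj_eq injv) (negbTE kt).
rewrite big1 // => k Pk; rewrite mnm1E (inj_eq injv).
by case: eqVneq Pk Pt => // -> ->.
Qed.

Definition xy i j : 'X_{1..n + n} := (U_(xvar i) + U_(yvar j))%MM.

Lemma xy_xE i j k : xy i j (xvar k) = (i == k).
Proof. by rewrite mnmDE !mnm1E !var_eqE addn0. Qed.

Lemma xy_yE i j k : xy i j (yvar k) = (j == k).
Proof. by rewrite mnmDE !mnm1E !var_eqE. Qed.

(** The binomial attached to a path with l inner vertices: b_ij when the path is
    odd (l even), g_ij when it is even. *)
Definition path_binomial i j l : {mpoly K[n + n]} :=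
  x_ K i * y_ K j + (-1) ^+ l * (x_ K j * y_ K i).

Lemma path_binomialE i j l :
  path_binomial i j l = if odd l then g_ K i j else b_ K i j.
Proof.
rewrite /path_binomial -signr_odd.
by case: (odd l); rewrite ?expr1 ?mulN1r ?expr0 ?mul1r.
Qed.

Lemma is_lead_path_binomial w i j l : (i < j)%N ->
  is_lead (@lex_le (n + n)) ('X_[w] * path_binomial i j l) (w + xy i j)%MM.
Proof.
move=> ij; have -> : 'X_[w] * path_binomial i j l
    = 'X_[(w + xy i j)%MM] + (-1) ^+ l *: 'X_[(w + xy j i)%MM].
  rewrite /path_binomial /x_ /y_ /xy !mpolyXD.
  rewrite -(signr_odd K) -(signr_odd {mpoly K[n + n]}).
  by case: (odd l); rewrite ?expr1 ?scaleN1r ?expr0 ?scale1r; ring.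
have lt_i : ((w + xy j i)%MM (xvar i) < (w + xy i j)%MM (xvar i))%N.
  rewrite !mnmDE !mnm1E !var_eqE eqxx -val_eqE /=; lia.
apply: is_lead_binomial; first by apply: contraTneq lt_i => ->; rewrite ltnn.
apply: lex_le_first_diff lt_i => t ti.
rewrite !mnmDE !mnm1E -!val_eqE /=; rewrite /= in ti.
have := ltn_ord i; lia.
Qed.

End Monomials.

(** * The listed elements belong to the ideal *)

Section Membership.

Set Implicit Arguments.
Unset Strict Implicit.
Import GRing.Theory.

Variables (n : nat) (K : fieldType) (e : rel 'I_n).
Hypotheses (e_sym : symmetric e) (e_irr : irreflexive e).
Implicit Types (i j k : 'I_n) (p q s : seq 'I_n).
Local Notation Pi := (@perm_edge_ideal n K e).

Lemma perm_edge_relation i j : e i j -> Pi (x_ K i * y_ K j + x_ K j * y_ K i).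
Proof. by move=> eij; apply: ideal_gen_mem; exists i, j. Qed.

Lemma perm_edge_relation_swap i j :
  e i j -> Pi (y_ K i * x_ K j + y_ K j * x_ K i).
Proof.
move=> eij; apply: ideal_gen_mem; exists i, j; split=> //.
by rewrite /b_; ring.
Qed.

Lemma admissible_rcons i j s : admissible e i j (rcons s j) =
  [&& (i < j)%N, path e i (rcons s j), uniq (i :: rcons s j)
    & all (fun k : 'I_n => (k < i)%N || (j < k)%N) s].
Proof.
rewrite /admissible /is_path last_rcons eqxx belast_rcons /=.
case ij: (i < j)%N; last by rewrite andbF.
have -> : i != j by apply: contraTneq ij => ->; rewrite ltnn.
by case: (path _ _ _); case: (uniq _); rewrite ?andbT ?andbF.
Qed.

Lemma admissibleP i j p :
  admissible e i j p -> exists s, p = rcons s j.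
Proof.
case/andP=> /and4P[ij _ /eqP lp _] _.
case/lastP: p lp ij => [/= -> | s k]; rewrite ?eqxx // last_rcons => ->.
by exists s.
Qed.

Lemma u_xE i j p k : u_ i j p (xvar k) = ((k \in i :: p) && (j < k)%N).
Proof.
rewrite /u_ mnmDE (@sum_varE _ _ (@xvar n) _ (@lshift_inj n n)) mnm_sumE inE.
rewrite big1 ?addn0 //.
by move=> l _; rewrite mnm1E var_eqE.
Qed.

Lemma u_yE i j p k : u_ i j p (yvar k) = ((k \in i :: p) && (k < i)%N).
Proof.
rewrite /u_ mnmDE (@sum_varE _ _ (@yvar n) _ (@rshift_inj n n)) mnm_sumE inE.
rewrite big1 ?add0n //.
by move=> l _; rewrite mnm1E var_eqE.
Qed.

Lemma u_inner i j s : admissible e i j (rcons s j) ->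
  'X_[u_ i j (rcons s j)] =
  \prod_(k <- s) (if (j < k)%N then x_ K k else y_ K k).
Proof.
rewrite admissible_rcons => /and4P[ij _ uns /allP ins].
rewrite (eq_bigr (fun k => 'X_[U_(if (j < k)%N then xvar k else yvar k)])).
  rewrite mprodXE; congr mpolyX.
  rewrite /u_ big_mkcondr [X in (_ + X)%MM]big_mkcondr -big_split /=.
  rewrite (eq_bigl (mem (i :: rcons s j))) => [|k]; last by rewrite inE.
  rewrite -big_uniq // big_cons -cats1 big_cat big_seq1 /=.
  (* Neither i nor j is smaller than i or larger than j. *)
  rewrite !ltnn (ltnNge j i) (ltnW ij) !addm0 add0m.
  apply: eq_big_seq => k /ins /orP[ki|jk].
    by rewrite ki ltnNge (ltnW (ltn_trans ki ij)) add0m.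
  by rewrite jk ltnNge (ltnW (ltn_trans ij jk)) addm0.
by move=> k _; case: ifP.
Qed.

Lemma adm_path_binomial_mem i j p : admissible e i j p ->
  Pi ('X_[u_ i j p] * path_binomial K i j (size p).-1).
Proof.
move=> adm; have [s ps] := admissibleP adm; rewrite ps in adm *.
rewrite u_inner // size_rcons; apply: path_binomial_mem.
  exact: perm_edge_relation.
by move: adm; rewrite admissible_rcons => /and4P[].
Qed.

Lemma gb_odd_mem i j p : odd_adm e i j p -> Pi ('X_[u_ i j p] * b_ K i j).
Proof.
case/andP=> adm op; have := adm_path_binomial_mem adm.
by rewrite path_binomialE; case: (size p) op => //= l /negbTE ->.
Qed.

Lemma gb_even_mem i j p : even_adm e i j p -> Pi ('X_[u_ i j p] * g_ K i j).
Proof.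
case/andP=> adm op; have := adm_path_binomial_mem adm.
rewrite path_binomialE; have [s ps] := admissibleP adm.
by move: op; rewrite ps size_rcons /= negbK => ->.
Qed.

Hypothesis charK : 2%N \notin [pchar K].

Lemma half_mpoly : (2%:R^-1 : K)%:MP * 2%:R = 1 :> {mpoly K[n + n]}.
Proof.
have two0 : 2%:R != 0 :> K by move: charK; rewrite inE.
by rewrite -(mpolyC_nat _ _ 2) -mpolyCM mulVf // mpolyC1.
Qed.

Lemma gb_lcm_mem i j p q : odd_adm e i j p -> even_adm e i j q ->
  Pi ('X_[mlcm (u_ i j p) (u_ i j q)] * (y_ K i * x_ K j)).
Proof.
move=> /gb_odd_mem Jp /gb_even_mem Jq; set u := mlcm _ _.
have up := submK (lem_mlcml (u_ i j p) (u_ i j q)).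
have uq := submK (lem_mlcmr (u_ i j p) (u_ i j q)).
set vp := (_ - _)%MM in up; set vq := (_ - _)%MM in uq.
pose half : {mpoly K[n + n]} := (2%:R^-1 : K)%:MP.
have := ideal_gen_combination (half * 'X_[vp]) (- half * 'X_[vq]) Jp Jq.
congr ideal_gen.
have -> : half * 'X_[vp] * ('X_[u_ i j p] * b_ K i j)
    + - half * 'X_[vq] * ('X_[u_ i j q] * g_ K i j)
  = half * ('X_[vp] * 'X_[u_ i j p]) * b_ K i j
    - half * ('X_[vq] * 'X_[u_ i j q]) * g_ K i j by ring.
rewrite -(mpolyXD _ vp) -(mpolyXD _ vq) up uq -/u /b_ /g_.
rewrite -[RHS]mul1r -half_mpoly -/half; ring.
Qed.

Lemma verts_path i p : {subset p <= verts i p}.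
Proof. by move=> k kp; rewrite inE in_cons kp orbT. Qed.

Lemma path_back i p : path e i p ->
  exists r, [/\ path e (last i p) r, last (last i p) r = i
    & {subset r <= i :: p}].
Proof.
move=> pp; exists (rev (belast i p)); split.
- by rewrite rev_path (eq_path (e' := e)).
- by case: p {pp} => //= k p; rewrite rev_cons last_rcons.
- by move=> k; rewrite mem_rev => /mem_belast.
Qed.

Lemma path_to i p a : path e i p -> a \in i :: p ->
  exists r, [/\ path e i r, last i r = a & {subset r <= p}].
Proof.
move=> pp; rewrite in_cons => /predU1P[-> | ap]; first by exists [::].
case/splitPr: ap pp => p1 p2; rewrite -cat_rcons cat_path => /andP[pp _].
exists (rcons p1 a); split=> //; first by rewrite last_rcons.
by move=> k kp; rewrite mem_cat kp.
Qed.

Lemma tail_marked_mem X Y i j p q a c t :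
  (forall h k, e h k -> Pi (X h * Y k + X k * Y h)) ->
  odd_adm e i j p -> even_adm e i j q -> tail_path e i p q a c t ->
  Pi (Y c * \prod_(h in W_ i p q a t c) X h).
Proof.
move=> edge /andP[/andP[/and4P[_ pp /eqP lp _] _] op].
case/andP=> /andP[/and4P[_ pq /eqP lq _] _] oq.
case/andP=> /and4P[_ pt /eqP lt _] /eqP meet.
pose V := verts i p :|: verts i q :|: verts a t.
have pV : {subset p <= V}.
  by move=> k /(@verts_path i) kV; rewrite /V 2!in_setU kV.
have qV : {subset q <= V}.
  by move=> k /(@verts_path i) kV; rewrite /V 2!in_setU kV orbT.
have tV : {subset t <= V}.
  by move=> k /(@verts_path a) kV; rewrite /V in_setU kV orbT.
have iV : i \in V by rewrite !inE eqxx.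
have aV : a \in V by rewrite !inE eqxx ?orbT.
have cV : c \in V.
  by rewrite -lt; have := mem_last a t; rewrite in_cons => /predU1P[->|/tV].
(* A walk c - a - i : back along the tail, then back along p or q. *)
have [r1 [pr1 lr1 sr1]] := path_back pt; rewrite lt in pr1 lr1.
have [r2 [pr2 lr2 sr2]] : exists r,
    [/\ path e a r, last a r = i & {subset r <= V}].
  have : a \in verts i p :|: verts i q.
    by have /setIP[] : a \in verts a t :&: (verts i p :|: verts i q)
      by rewrite meet set11.
  case/setUP; rewrite inE => /path_to h.
    have [r [pr lr sr]] := h pp; have [r' [pr' lr' sr']] := path_back pr.
    rewrite lr in pr' lr'; exists r'; split=> // k /sr'.
    by rewrite in_cons => /predU1P[->|/sr/pV].
  have [r [pr lr sr]] := h pq; have [r' [pr' lr' sr']] := path_back pr.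
  rewrite lr in pr' lr'; exists r'; split=> // k /sr'.
  by rewrite in_cons => /predU1P[->|/sr/qV].
apply: (marked_mem edge e_irr half_mpoly pp pq _ op oq iV pV qV
  (a := c) (r := r1 ++ r2)) => //.
- by rewrite lp lq.
- by rewrite cat_path pr1 lr1.
- by rewrite last_cat lr1.
move=> k; rewrite mem_cat => /orP[/sr1|/sr2] //.
by rewrite in_cons => /predU1P[->|/tV].
Qed.

Lemma perm_edge_gb_mem f : perm_edge_gb e f -> Pi f.
Proof.
case=> {f} [i j p|i j p|i j p q|i j p q a c t|i j p q a c t].
- exact: gb_odd_mem.
- exact: gb_even_mem.
- exact: gb_lcm_mem.
- by move=> op oq tp _; apply: (tail_marked_mem perm_edge_relation op oq tp).
- move=> op oq tp _.
  exact: (tail_marked_mem (X := y_ K) (Y := x_ K) perm_edge_relation_swap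
    op oq tp).
Qed.

End Membership.

(** * Parity of walks, odd cycles and shortest connections *)

Section Walks.

Set Implicit Arguments.
Unset Strict Implicit.

Variables (T : finType) (r : rel T).
Implicit Types (i j k : T) (p q s c : seq T).

(** The bipartite double cover of a graph: its walks are those of the graph,
    together with a bit that records the parity of their length. *)
Definition parity_cover : rel (T * bool) :=
  [rel u v | r u.1 v.1 && (v.2 == ~~ u.2)].

Lemma parity_coverP i j a b :
  reflect (exists p, [/\ path r i p, last i p = j & odd (size p) = a (+) b])
    (connect parity_cover (i, a) (j, b)).
Proof.
apply: (iffP connectP) => [[w]|[p [pp lp op]]].
  elim: w i a => [|[k d] w IHw] i a /=.
    by move=> _ [<- <-]; exists [::]; rewrite addbb.
  rewrite /parity_cover /=; case/andP=> /andP[rik /eqP ->] /IHw h /h.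
  case=> p [pp lp op]; exists (k :: p); rewrite /= rik pp lp op.
  by split=> //; case: (a); case: (b).
elim: p i a pp lp op => [|k p IHp] i a /=.
  by move=> _ <-; case: a b => [] [] // _; exists [::].
case/andP=> rik pp lp op.
case: (IHp k (~~ a) pp lp) => [|w pw lw].
  by rewrite addNb -op negbK.
by exists ((k, ~~ a) :: w); rewrite //= /parity_cover /= rik eqxx pw.
Qed.

Lemma repeated_split s : ~~ uniq s ->
  exists k s1 s2 s3, s = s1 ++ k :: s2 ++ k :: s3.
Proof.
elim: s => //= k s IHs; rewrite negb_and negbK => /orP[ks|/IHs].
  by case/splitPr: ks => s2 s3; exists k, [::], s2, s3.
by case=> l [s1 [s2 [s3 ->]]]; exists l, (k :: s1), s2, s3.
Qed.

(** A repeated vertex splits a closed walk into two shorter ones, one of which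
    is odd. *)
Lemma odd_closed_walk_cycle i p : path r i p -> last i p = i -> odd (size p) ->
  exists c, [/\ uniq c, cycle r c, odd (size c) & {subset c <= p}].
Proof.
have [l] := ubnP (size p); elim: l i p => // l IHl i p /ltnSE szl pp lp op.
have [up|] := boolP (uniq p).
  case/lastP: p => // s k in pp lp op szl up *.
  rewrite last_rcons in lp; rewrite lp in pp up *.
  exists (i :: s); split=> //.
  - by rewrite /= -rcons_uniq.
  - by move: op; rewrite size_rcons.
  - by move=> z; rewrite mem_rcons.
case/repeated_split=> k [s1 [s2 [s3 ps]]]; rewrite {p}ps in pp lp op szl *.
rewrite -cat_rcons -(cat_rcons k s2) !cat_path !last_rcons in pp.
case/and3P: pp => pp1 pp2 pp3.
have [os2|es2] := boolP (odd (size (rcons s2 k))).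
  case: (IHl k (rcons s2 k)) => [| | | |c [uc cc oc sub]] //.
  - by rewrite size_rcons; move: szl; rewrite !size_cat /= size_cat /=; lia.
  - by rewrite last_rcons.
  exists c; split=> // z /sub; rewrite mem_rcons !(inE, mem_cat).
  by case/orP=> ->; rewrite ?orbT.
case: (IHl i (rcons s1 k ++ s3)) => [| | | |c [uc cc oc sub]] //.
- rewrite size_cat size_rcons; move: szl.
  by rewrite !size_cat /= size_cat /=; lia.
- by rewrite cat_path last_rcons pp1 pp3.
- by rewrite last_cat last_rcons; move: lp; rewrite !last_cat /= !last_cat /=.
- move: op es2; rewrite !size_cat !size_rcons /= size_cat /=; lia.
exists c; split=> // z /sub; rewrite mem_cat mem_rcons !(inE, mem_cat).
by case/orP=> [/orP[]|] ->; rewrite ?orbT.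
Qed.

(** On a path from Z to D, cut at the last vertex in Z and at the next one
    in D. *)
Lemma path_between (Z D : pred T) i p :
  path r i p -> Z i -> D (last i p) -> (forall k, Z k -> ~~ D k) ->
  exists a s b, [/\ path r a (rcons s b), uniq (a :: rcons s b), Z a, D b
    & forall k, k \in s -> ~~ Z k /\ ~~ D k].
Proof.
move=> + + + ZD; have [l] := ubnP (size p).
elim: l i p => // l IHl i p0 /ltnSE szl pp0 Zi.
case: (shortenP pp0) => p pp up sub Dp.
have {p0 pp0 sub}szl : (size p <= l)%N.
  by apply: leq_trans szl; case/andP: up => _ /uniq_leq_size; apply.
case/lastP: p => [|s b] in pp up szl Dp *; first by have /negP := ZD _ Zi.
rewrite last_rcons in Dp; have nZb : ~~ Z b by apply: contraL Dp; apply: ZD.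
have [/hasP[k ks Zk]|noZ] := boolP (has Z s).
  case/splitPr: ks => s1 s2 in pp szl up *.
  rewrite rcons_cat rcons_cons -cat_rcons cat_path last_rcons in pp.
  case/andP: pp => _ pp; apply: (IHl k (rcons s2 b)) => //.
    by move: szl; rewrite !size_rcons size_cat /=; lia.
  by rewrite last_rcons.
have [/hasP[k ks Dk]|noD] := boolP (has D s).
  case/splitPr: ks => s1 s2 in pp szl up *.
  rewrite rcons_cat rcons_cons -cat_rcons cat_path in pp.
  case/andP: pp => pp _; apply: (IHl i (rcons s1 k)) => //.
    by move: szl; rewrite !size_rcons size_cat /=; lia.
  by rewrite last_rcons.
exists i, s, b; split=> // k ks; split.
  exact: (hasPn noZ).
exact: (hasPn noD).
Qed.

Hypothesis r_sym : symmetric r.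

Lemma cycle_arcs c i j : uniq c -> cycle r c -> i \in c -> j \in c -> i != j ->
  exists s1 s2, [/\ path r i (rcons s1 j), path r i (rcons s2 j)
    & perm_eq (i :: j :: s1 ++ s2) c].
Proof.
move=> uc cc ic jc ij; case: (rot_to_arc uc ic jc ij) => d s1 s2 _ _ rc.
rewrite -(rot_cycle d) rc /= rcons_cat rcons_cons -cat_rcons in cc.
rewrite cat_path last_rcons in cc.
exists s1, (rev s2); split.
- by case/andP: cc.
- case/andP: cc => _.
  have := rev_path r j (rcons s2 i); rewrite last_rcons belast_rcons rev_cons.
  rewrite (eq_path (e' := r)) => [->|x y] //; exact: r_sym.
rewrite perm_sym -(perm_rot d) rc perm_cons -cat1s perm_catCA /= perm_cons.
by rewrite perm_cat2l perm_sym perm_rev.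
Qed.

(** Parity of a walk from the representative of the component: a proper
    2-colouring wherever one exists, see monochromatic_edge. *)
Definition colour i :=
  connect parity_cover (fingraph.root r i, false) (i, true).

Lemma parity_cover_conn_sym : connect_sym parity_cover.
Proof.
apply: sym_connect_sym => -[i a] [j b].
by rewrite /parity_cover /= r_sym; case: a b => [] [].
Qed.

Lemma parity_cover_flip i j a b :
  connect parity_cover (i, a) (j, b) ->
  connect parity_cover (i, ~~ a) (j, ~~ b).
Proof.
case/parity_coverP=> p [pp lp op]; apply/parity_coverP; exists p.
by rewrite addNb addbN negbK.
Qed.

(** An edge whose ends have the same colour closes an odd walk. *)
Lemma monochromatic_edge i j : r i j -> colour i = colour j ->
  connect parity_cover (fingraph.root r i, false) (fingraph.root r i, true).
Proof.
have r_conn_sym := sym_connect_sym r_sym.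
move=> rij; have roots : fingraph.root r i = fingraph.root r j.
  by apply/(fingraph.rootP r_conn_sym)/connect1.
have step a : connect parity_cover (i, a) (j, ~~ a).
  by apply: connect1; rewrite /parity_cover /= rij eqxx.
rewrite /colour -roots; set k := fingraph.root r i.
case ci: (connect parity_cover (k, false) (i, true)) => /esym cj.
  apply: connect_trans ci _; apply: connect_trans (step true) _.
  by rewrite parity_cover_conn_sym; apply: (parity_cover_flip cj).
have [[] pi] : exists a, connect parity_cover (k, false) (i, a).
- have /connectP[p pp lp] : connect r k i by rewrite r_conn_sym connect_root.
  by exists (odd (size p)); apply/parity_coverP; exists p.
- by rewrite ci in pi.
by have := connect_trans pi (step false); rewrite cj.
Qed.

End Walks.

(** * Non-standard monomials are divisible by a listed leading monomial *)

Section Divisibility.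

Set Implicit Arguments.
Unset Strict Implicit.
Import GRing.Theory.

Variables (n : nat) (K : fieldType) (e : rel 'I_n) (m : 'X_{1..n + n}).
Hypotheses (e_sym : symmetric e) (e_irr : irreflexive e).
Implicit Types (i j k : 'I_n) (p q s c : seq 'I_n).

Definition gb_divides := exists (f : {mpoly K[n + n]}) u,
  [/\ perm_edge_gb e f, is_lead (@lex_le (n + n)) f u & (u <= m)%MM].

Definition has_x k := (0 < m (xvar k))%N.
Definition has_y k := (0 < m (yvar k))%N.
Definition occurs k := has_x k || has_y k.
(** The edges of the graph G_m induced on the vertices that occur in m. *)
Definition supp_edge : rel 'I_n := [rel i j | [&& e i j, occurs i & occurs j]].

Lemma supp_edge_sym : symmetric supp_edge.
Proof. by move=> i j; rewrite /supp_edge /= e_sym [occurs i && _]andbC. Qed.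

Lemma supp_path i p : path supp_edge i p -> path e i p /\ all occurs p.
Proof.
elim: p i => //= k p IHp i /andP[/and3P[-> _ ->] /IHp[-> ->]] //.
Qed.

(** As the variables of u_pi belong to inner vertices, they do not interfere
    with the variables of the two end points, which are collected in w. *)
Lemma u_times_divides i j p w : (i < j)%N -> (w <= m)%MM ->
  (forall k, k != i -> k != j -> w (xvar k) = 0%N /\ w (yvar k) = 0%N) ->
  (forall k, k \in i :: p -> (k < i)%N -> has_y k) ->
  (forall k, k \in i :: p -> (j < k)%N -> has_x k) ->
  (u_ i j p + w <= m)%MM.
Proof.
move=> ij /mnm_lepP wm w0 lowy highx.
apply: mnm_var_lepP => k; rewrite mnmDE ?u_xE ?u_yE.
  case: andP => [[kp jk]|_]; last exact: wm.
  have [] := w0 k; rewrite -?val_eqE /=; [lia | lia | move=> -> _].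
  exact: highx.
case: andP => [[kp ki]|_]; last exact: wm.
have [] := w0 k; rewrite -?val_eqE /=; [lia | lia | move=> _ ->].
exact: lowy.
Qed.

Lemma xy_divides i j : has_x i -> has_y j -> (xy i j <= m)%MM.
Proof.
move=> xi yj; apply: mnm_var_lepP => k; rewrite ?xy_xE ?xy_yE;
  by case: eqP => // <-.
Qed.

Lemma xy_other i j k : k != i -> k != j ->
  xy i j (xvar k) = 0%N /\ xy i j (yvar k) = 0%N.
Proof.
by move=> ki kj; rewrite xy_xE xy_yE !(eq_sym _ k) (negbTE ki) (negbTE kj).
Qed.

(** Along a path of minimal length among all such pairs (i, j), an inner vertex
    k with x_k and k < j, or with y_k and i < k, would give a shorter path; so
    k < i and only y_k occurs, or k > j and only x_k occurs. *)
Lemma inversion_divides i j p :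
  (i < j)%N -> has_x i -> has_y j -> path supp_edge i p -> last i p = j ->
  gb_divides.
Proof.
have [l] := ubnP (size p); elim: l i j p => // l IHl i j p0 /ltnSE szl.
move=> ij xi yj pp0; case: (shortenP pp0) => p pp up psub lp.
have {}szl : (size p <= l)%N.
  by apply: leq_trans szl; case/andP: up => _ /uniq_leq_size; apply.
have {p0 pp0 psub}[pe /allP occ] := supp_path pp.
case/lastP: p => [|s k] in pp up lp szl pe occ *.
  by rewrite -lp ltnn in ij.
rewrite last_rcons in lp; rewrite {k}lp in pp up szl pe occ *.
pose bad k := has_x k && (k < j)%N || has_y k && (i < k)%N.
case: (hasP (a := bad) (s := s)) => [[k ks]|good].
  case/splitPr: ks => s1 s2 in pp up szl pe occ *.
  rewrite rcons_cat rcons_cons -cat_rcons cat_path last_rcons in pp.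
  rewrite size_rcons size_cat /= in szl.
  case/andP: pp => pp1 pp2 /orP[] /andP[hk kij].
    apply: (IHl k j (rcons s2 j)); rewrite ?last_rcons ?size_rcons //; lia.
  apply: (IHl i k (rcons s1 k)); rewrite ?last_rcons ?size_rcons //; lia.
have good' k : k \in s -> (k < j -> ~~ has_x k)%N /\ (i < k -> ~~ has_y k)%N.
  move=> ks; split=> kij; apply/negP=> hk; apply: good; exists k => //.
    by rewrite /bad hk kij.
  by rewrite /bad hk kij orbT.
have occ' k : k \in s -> has_x k || has_y k.
  by move=> ks; apply: occ; rewrite mem_rcons inE ks orbT.
have adm : admissible e i j (rcons s j).
  rewrite admissible_rcons ij pe up /=; apply/allP=> k ks.
  have [nx ny] := good' k ks; have := occ' k ks.
  move: up; rewrite /= rcons_uniq mem_rcons inE negb_or.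
  case/andP=> /andP[_ iins] /andP[jns _].
  have ki : k != i :> nat by apply: contraNneq iins => /val_inj <-.
  have kj : k != j :> nat by apply: contraNneq jns => /val_inj <-.
  case: (ltngtP k i) (ltngtP k j) ki kj nx ny => // ik [] // kj _ _ nx ny.
  by rewrite (negbTE (nx isT)) (negbTE (ny isT)).
exists ('X_[u_ i j (rcons s j)] * path_binomial K i j (size s)).
exists (u_ i j (rcons s j) + xy i j)%MM; split.
- rewrite path_binomialE; case: ifP => os.
    by apply: gb_even; rewrite /even_adm adm size_rcons /= os.
  by apply: gb_odd; rewrite /odd_adm adm size_rcons /= os.
- exact: is_lead_path_binomial.
apply: (u_times_divides ij (xy_divides xi yj) (@xy_other i j)) => k.
  rewrite inE mem_rcons inE => /or3P[/eqP->|/eqP->|ks] ki.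
  - by rewrite ltnn in ki.
  - by rewrite ltnNge (ltnW ij) in ki.
  have [nx _] := good' k ks; have := occ' k ks.
  by rewrite (negbTE (nx (ltn_trans ki ij))).
rewrite inE mem_rcons inE => /or3P[/eqP->|/eqP->|ks] jk.
- by rewrite ltnNge (ltnW ij) in jk.
- by rewrite ltnn in jk.
have [_ ny] := good' k ks; have := occ' k ks.
by rewrite (negbTE (ny (ltn_trans ij jk))) orbF.
Qed.

(** When no label of an odd cycle lies strictly between i and j, both arcs
    from i to j are admissible, and their lengths have an odd sum. *)
Lemma cycle_adm_pair c i j :
  uniq c -> cycle e c -> odd (size c) -> i \in c -> j \in c -> (i < j)%N ->
  (forall k, k \in c -> (k <= i)%N || (j <= k)%N) ->
  exists p q, [/\ odd_adm e i j p, even_adm e i j q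
    & verts i p :|: verts i q = [set k in c]].
Proof.
move=> uc cc oc ic jc ij gap.
have nij : i != j by apply: contraTneq ij => ->; rewrite ltnn.
have [s1 [s2 [p1 p2 pc]]] := cycle_arcs e_sym uc cc ic jc nij.
have u12 : uniq (i :: j :: s1 ++ s2) by rewrite (perm_uniq pc).
have adm s : path e i (rcons s j) -> subseq s (s1 ++ s2) ->
    admissible e i j (rcons s j).
  move=> pe sub; have us : uniq (i :: j :: s).
    by apply: subseq_uniq u12; rewrite /= !eqxx.
  have uni : uniq (i :: rcons s j).
    by rewrite (perm_uniq (s2 := i :: j :: s)) // perm_cons perm_rcons.
  rewrite admissible_rcons ij pe uni; apply/allP=> k ks.
  have kc : k \in c by rewrite -(perm_mem pc) !inE (mem_subseq sub ks) !orbT.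
  move: us; rewrite /= inE negb_or => /and3P[/andP[_ iins] jns _].
  have ki : k != i :> nat by apply: contraNneq iins => /val_inj <-.
  have kj : k != j :> nat by apply: contraNneq jns => /val_inj <-.
  by have := gap k kc; move: ki kj; case: ltngtP => // _ _; case: ltngtP.
have adm1 := adm s1 p1 (prefix_subseq _ _).
have adm2 := adm s2 p2 (suffix_subseq _ _).
have par : odd (size s1) = ~~ odd (size s2).
  move: oc; rewrite -(perm_size pc) /= size_cat oddD negbK.
  by case: (odd (size s1)); case: (odd (size s2)).
have cover s s' : perm_eq (s ++ s') (s1 ++ s2) ->
    verts i (rcons s j) :|: verts i (rcons s' j) = [set k in c].
  move=> ss; apply/setP=> k; rewrite !inE !mem_rcons !inE -(perm_mem pc) !inE.
  rewrite -(perm_mem ss) mem_cat.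
  by case: (k == i); case: (k == j); rewrite //= ?orbT.
have [o2|e2] := boolP (odd (size s2)).
  exists (rcons s1 j), (rcons s2 j); split; last exact: cover.
    by rewrite /odd_adm adm1 size_rcons /= par o2.
  by rewrite /even_adm adm2 size_rcons /= o2.
exists (rcons s2 j), (rcons s1 j).
split; last by apply: cover; rewrite perm_catC.
  by rewrite /odd_adm adm2 size_rcons.
by rewrite /even_adm adm1 size_rcons /= par e2.
Qed.

(** Among the pairs that carry R below Q, one with the least difference has no
    vertex of c in between, because that vertex would carry R or Q and give a
    closer pair. *)
Lemma closest_pair (R Q : pred 'I_n) c i j :
  i \in c -> j \in c -> R i -> Q j -> (i < j)%N ->
  (forall k, k \in c -> R k || Q k) ->
  exists i' j', [/\ i' \in c /\ j' \in c, R i', Q j', (i' < j')%N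
    & forall k, k \in c -> (k <= i')%N || (j' <= k)%N].
Proof.
move=> + + + + + RQ; have [l] := ubnP (j - i)%N.
elim: l i j => // l IHl i j /ltnSE szl ic jc Ri Qj ij.
have [/hasP[k kc /andP[ik kj]]|none] :=
    boolP (has (fun k : 'I_n => (i < k)%N && (k < j)%N) c).
  have [Rk|Qk] := orP (RQ k kc).
    by apply: (IHl k j) => //; lia.
  by apply: (IHl i k) => //; lia.
exists i, j; split=> // k kc; have := hasPn none k kc; lia.
Qed.

Lemma lcm_divides (u v w : 'X_{1..n + n}) :
  (u + w <= m)%MM -> (v + w <= m)%MM -> (mlcm u v + w <= m)%MM.
Proof.
move=> /mnm_lepP uw /mnm_lepP vw; apply/mnm_lepP=> t.
by have := uw t; have := vw t; rewrite !mnmDE mnmE; lia.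
Qed.

Lemma marked_divides (v v' : 'I_n -> 'I_(n + n)) (W : {set 'I_n}) b :
  injective v -> injective v' -> (forall i j, v i != v' j) ->
  (forall t, exists k, t = v k \/ t = v' k) ->
  (0 < m (v' b))%N -> (forall h, h \in W -> (0 < m (v h))%N) ->
  (U_(v' b) + \sum_(h in W) U_(v h) <= m)%MM.
Proof.
move=> injv injv' vv' cover mb mW; apply/mnm_lepP=> t; rewrite mnmDE mnm1E.
have [k [->|->]] := cover t.
  rewrite sum_varE // eq_sym (negbTE (vv' _ _)).
  by case: (boolP (k \in W)) => // /mW.
rewrite mnm_sumE big1 => [|h _]; last by rewrite mnm1E (negbTE (vv' _ _)).
by rewrite addn0 (inj_eq injv'); case: eqP => // <-.
Qed.

Variable r0 : 'I_n.
Local Notation comp := (connect supp_edge r0).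

Hypothesis no_inversion : forall i j,
  comp i -> comp j -> has_x i -> has_y j -> (j <= i)%N.

(** This is where the elements of kind (iii) are needed: at the place where the
    cycle passes from the letter y to the letter x, as no inversion occurs, all
    labels below carry y and all labels above carry x. *)
Lemma odd_cycle_straddling c i j :
  uniq c -> cycle e c -> odd (size c) ->
  (forall k, k \in c -> comp k && occurs k) ->
  i \in c -> j \in c -> has_y i -> has_x j -> (i < j)%N -> gb_divides.
Proof.
move=> uc cc oc inC i0c j0c yi0 xj0 ij0.
have [|i' [j' [[ic jc] yi xj ij gap]]] :=
    closest_pair (R := has_y) (Q := has_x) i0c j0c yi0 xj0 ij0.
  by move=> k /inC /andP[_]; rewrite orbC.
have [p [q [op oq pqc]]] := cycle_adm_pair uc cc oc ic jc ij gap.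
have lowy k : k \in c -> (k < i')%N -> has_y k.
  move=> kc ki; have /andP[kC /orP[xk|//]] := inC k kc.
  have /andP[iC _] := inC i' ic.
  by have := no_inversion kC iC xk yi; rewrite leqNgt ki.
have highx k : k \in c -> (j' < k)%N -> has_x k.
  move=> kc jk; have /andP[kC /orP[//|yk]] := inC k kc.
  have /andP[jC _] := inC j' jc.
  by have := no_inversion jC kC xj yk; rewrite leqNgt jk.
have pc k : k \in i' :: p -> k \in c.
  have /setP/(_ k) := pqc; rewrite in_setU !(inE, in_set) => h kp.
  by rewrite -h kp.
have qc k : k \in i' :: q -> k \in c.
  have /setP/(_ k) := pqc; rewrite in_setU !(inE, in_set) => h kq.
  by rewrite -h kq orbT.
have w0 k : k != i' -> k != j' -> _ := fun ki kj => xy_other kj ki.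
exists ('X_[mlcm (u_ i' j' p) (u_ i' j' q)] * (y_ K i' * x_ K j')).
exists (mlcm (u_ i' j' p) (u_ i' j' q) + xy j' i')%MM; split.
- exact: gb_lcm.
- rewrite /x_ /y_ -!mpolyXD [(U_(yvar i') + _)%MM]addmC.
  exact: is_lead_monomial.
have wm := xy_divides xj yi.
by apply: lcm_divides; apply: (u_times_divides ij wm w0) => k /[dup];
  [move/pc=> kc _; apply: lowy | move/pc=> kc _; apply: highx
  |move/qc=> kc _; apply: lowy | move/qc=> kc _; apply: highx].
Qed.

(** The data of an element of kind (iv): D is the set of vertices that carry the
    letter missing from the cycle, and the tail stops at the first of them. *)
Lemma odd_cycle_tail (D : pred 'I_n) c b :
  uniq c -> cycle e c -> odd (size c) ->
  (forall k, k \in c -> [&& comp k, occurs k & ~~ D k]) ->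
  comp b -> D b ->
  exists i j p q a t d, [/\ odd_adm e i j p, even_adm e i j q,
    tail_path e i p q a d t, comp d /\ D d
    & forall h, h \in W_ i p q a t d ->
        [/\ comp h, occurs h, ~~ D h & h != d]].
Proof.
move=> uc cc oc inC bC Db.
have [i0 [j0 [i0c j0c ij0]]] : exists i j, [/\ i \in c, j \in c & (i < j)%N].
  case: c uc cc oc {inC} => [|x [|y c]] //=; first by rewrite e_irr.
  rewrite inE negb_or -val_eqE /= neq_ltn => /andP[/andP[/orP[xy|yx] _] _] _ _.
    by exists x, y; rewrite !inE !eqxx orbT.
  by exists y, x; rewrite !inE !eqxx orbT.
have [//|i [j [[ic jc] _ _ ij gap]]] :=
  closest_pair (R := predT) (Q := predT) i0c j0c isT isT ij0.
have [p [q [op oq pqc]]] := cycle_adm_pair uc cc oc ic jc ij gap.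
have conn_sym := sym_connect_sym supp_edge_sym.
have /connectP[w pw bw] : connect supp_edge i b.
  by apply: connect_trans bC; rewrite conn_sym; have /and3P[] := inC i ic.
have [||a [s [d [ps us ac Dd sP]]]] :=
    path_between (Z := mem c) (D := D) pw ic.
  by rewrite -bw.
  by move=> k /inC /and3P[].
change (is_true (a \in c)) in ac; have [pes occs] := supp_path ps.
have aC : comp a by have /and3P[] := inC a ac.
have tC k : k \in rcons s d -> comp k.
  move=> ks; apply: connect_trans aC _; apply: (path_connect ps).
  by rewrite inE ks orbT.
exists i, j, p, q, a, (rcons s d), d; split=> //.
- rewrite /tail_path /is_path pes last_rcons eqxx us andbT /= pqc.
  rewrite (contraTneq _ Dd); last by move=> <-; have /and3P[] := inC a ac.
  apply/eqP/setP=> k; rewrite !inE mem_rcons inE; case: (eqVneq k a) => [->|_].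
    by rewrite ac.
  case: (eqVneq k d) => [->|_] /=; last first.
    by apply/negP=> /andP[/sP[/negP]].
  by apply/negP=> /inC /and3P[_ _]; rewrite Dd.
- by split=> //; apply: tC; rewrite mem_rcons inE eqxx.
move=> h; rewrite /W_ pqc !inE mem_rcons inE => /andP[hd].
rewrite (negbTE hd) /= => /or3P[/inC/and3P[]|/eqP->|hs] //.
  by split=> //; have /and3P[] := inC a ac.
split=> //; last by case: (sP h hs).
  by apply: tC; rewrite mem_rcons inE hs orbT.
by apply: (allP occs); rewrite mem_rcons inE hs orbT.
Qed.

(** Without inversions, an odd cycle either straddles the threshold between y
    and x or carries a single letter: a vertex with both letters forces an
    inversion or a straddling pair with any other vertex of the cycle. *)
Lemma odd_component_divides p a b :
  path supp_edge r0 p -> last r0 p = r0 -> odd (size p) ->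
  comp a -> comp b -> has_x a -> has_y b -> gb_divides.
Proof.
move=> pp lp op aC bC xa yb.
have [c [uc cc oc sub]] := odd_closed_walk_cycle pp lp op.
have inC k : k \in c -> comp k && occurs k.
  move=> /sub kp; rewrite (path_connect pp) ?inE ?kp ?orbT //=.
  by have [_ /allP] := supp_path pp; apply.
have ce : cycle e c.
  by apply: sub_cycle cc => i j /andP[].
have [/hasP[i ic /hasP[j jc /and3P[yi xj ij]]]|none] := boolP (has
    (fun i => has (fun j : 'I_n => [&& has_y i, has_x j & (i < j)%N]) c) c).
  exact: odd_cycle_straddling inC ic jc yi xj ij.
have {}none i j : i \in c -> j \in c -> has_y i -> has_x j -> (j <= i)%N.
  move=> ic jc yi xj; rewrite leqNgt; apply: contra none => ij.
  by apply/hasP; exists i => //; apply/hasP; exists j; rewrite // yi xj ij.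
have {}none i j : i \in c -> j \in c -> has_y i -> has_x j -> i = j.
  move=> ic jc yi xj; apply/val_inj/anti_leq; rewrite (none _ _ ic jc) // andbT.
  have /andP[iC _] := inC i ic; have /andP[jC _] := inC j jc.
  exact: no_inversion.
have pure : (forall k, k \in c -> ~~ has_x k)
    \/ (forall k, k \in c -> ~~ has_y k).
  have [/hasP[l lc yl]|] := boolP (has has_y c); last first.
    by move/hasPn=> noy; right=> k /noy.
  left=> k kc; apply/negP=> xk; have lk := none l k lc kc yl xk.
  rewrite {l}lk in lc yl.
  have [z zc zk] : exists2 z, z \in c & z != k.
    case: (c) ce oc uc kc => [|x [|y d]] //=; first by rewrite e_irr.
    move=> _ _ /andP[xyd _] _; case: (eqVneq x k) => [xk'|nxk].
      exists y; rewrite ?inE ?eqxx ?orbT // -xk'.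
      by apply: contraNneq xyd => ->; rewrite inE eqxx.
    by exists x; rewrite ?inE ?eqxx.
  have /andP[_ /orP[xz|yz]] := inC z zc.
    by rewrite (none k z kc zc yl xz) eqxx in zk.
  by rewrite (none z k zc kc yz xk) eqxx in zk.
case: pure => pure.
  have [|i [j [p' [q [a' [t [d [adp adq tl [dC xd] WP]]]]]]]] :=
      odd_cycle_tail (D := has_x) uc ce oc _ aC xa.
    by move=> k kc; have /andP[-> ->] := inC k kc; rewrite pure.
  have yW h : h \in W_ i p' q a' t d -> has_y h.
    by case/WP=> _ /orP[->|//].
  exists (x_ K d * \prod_(h in W_ i p' q a' t d) y_ K h).
  exists (U_(xvar d) + \sum_(h in W_ i p' q a' t d) U_(yvar h))%MM; split.
  - apply: gb_high adp adq tl _ => h hW; have [hC _ _ hd] := WP h hW.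
    by rewrite ltn_neqAle hd no_inversion ?yW.
  - by rewrite /x_ /y_ mprodXE -mpolyXD; apply: is_lead_monomial.
  apply: marked_divides => //; [exact: rshift_inj|exact: lshift_inj| |].
    by move=> ? ?; rewrite var_eqE.
  by move=> v; have [k [|] ->] := var_cases v; exists k; [right|left].
have [|i [j [p' [q [a' [t [d [adp adq tl [dC yd] WP]]]]]]]] :=
    odd_cycle_tail (D := has_y) uc ce oc _ bC yb.
  by move=> k kc; have /andP[-> ->] := inC k kc; rewrite pure.
have xW h : h \in W_ i p' q a' t d -> has_x h.
  by case/WP=> _ /orP[//|->].
exists (y_ K d * \prod_(h in W_ i p' q a' t d) x_ K h).
exists (U_(yvar d) + \sum_(h in W_ i p' q a' t d) U_(xvar h))%MM; split.
- apply: gb_low adp adq tl _ => h hW; have [hC _ _ hd] := WP h hW.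
  by rewrite ltn_neqAle eq_sym hd no_inversion ?xW.
- by rewrite /x_ /y_ mprodXE -mpolyXD; apply: is_lead_monomial.
apply: marked_divides => //; [exact: lshift_inj|exact: rshift_inj| |].
  by move=> ? ?; rewrite var_eqE.
exact: var_cases.
Qed.

End Divisibility.

(** * The remaining monomials are not leading monomials of the ideal *)

Section StandardMonomials.

Set Implicit Arguments.
Unset Strict Implicit.
Import GRing.Theory.

Variables (n : nat) (K : fieldType) (e : rel 'I_n) (m : 'X_{1..n + n}).
Hypotheses (e_sym : symmetric e) (e_irr : irreflexive e).
Implicit Types (i j k : 'I_n) (v w : 'X_{1..n + n}).

Local Notation sedge := (supp_edge e m).
Local Notation cover := (parity_cover sedge).

Lemma sedge_conn_sym : connect_sym sedge.
Proof. exact/sym_connect_sym/supp_edge_sym. Qed.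

(** The invariants of the token moves: the multidegree and the number of y's in
    each component of G_m.  For w of the multidegree of m the components are
    the same as those of m. *)
Definition same_class w :=
  [forall i, w (xvar i) + w (yvar i) == m (xvar i) + m (yvar i)]%N &&
  [forall r, \sum_(i | connect sedge r i) w (yvar i)
             == \sum_(i | connect sedge r i) m (yvar i)]%N.

Lemma same_classP w : reflect
  ((forall i, w (xvar i) + w (yvar i) = m (xvar i) + m (yvar i)) /\
   (forall r, \sum_(i | connect sedge r i) w (yvar i)
             = \sum_(i | connect sedge r i) m (yvar i)))%N (same_class w).
Proof.
apply: (iffP andP) => -[h1 h2]; split.
- by move=> i; apply/eqP; apply: (forallP h1).
- by move=> i; apply/eqP; apply: (forallP h2).
- by apply/forallP=> i; apply/eqP.
by apply/forallP=> i; apply/eqP.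
Qed.

Lemma same_class_refl : same_class m.
Proof. exact/same_classP. Qed.

Lemma same_class_mdeg w : same_class w -> mdeg w = mdeg m.
Proof.
case/same_classP=> deg _; rewrite !mdegE !big_split_ord /= -!big_split /=.
by apply: eq_bigr => i _; apply: deg.
Qed.

Lemma sum_xy_y (P : pred 'I_n) w i j :
  (\sum_(k | P k) (w + xy i j)%MM (yvar k)
   = \sum_(k | P k) w (yvar k) + P j)%N.
Proof.
under eq_bigr do rewrite mnmDE xy_yE; rewrite big_split /=; congr (_ + _)%N.
case: (boolP (P j)) => Pj.
  rewrite (bigD1 j) //= eqxx big1 // => k /andP[_ /negbTE].
  by rewrite eq_sym => ->.
by rewrite big1 // => k Pk; case: eqP Pj => // ->; rewrite Pk.
Qed.

Lemma swap_deg w i j k :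
  ((w + xy i j)%MM (xvar k) + (w + xy i j)%MM (yvar k)
   = (w + xy j i)%MM (xvar k) + (w + xy j i)%MM (yvar k))%N.
Proof. by rewrite !(mnmDE _ w) !xy_xE !xy_yE; lia. Qed.

Lemma same_class_supp_edge w i j :
  e i j -> same_class (w + xy i j)%MM -> sedge i j.
Proof.
move=> eij /same_classP[deg _]; rewrite /supp_edge /= eij /occurs /has_x /has_y.
have := deg i; have := deg j; rewrite !(mnmDE _ w) !xy_xE !xy_yE !eqxx /=; lia.
Qed.

Lemma same_class_swap_imp w i j :
  e i j -> same_class (w + xy i j)%MM -> same_class (w + xy j i)%MM.
Proof.
move=> eij cls; have sij := same_class_supp_edge eij cls.
case/same_classP: cls => deg sum; apply/same_classP; split=> [k|r].
  by rewrite -swap_deg.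
rewrite -sum !sum_xy_y; congr (_ + nat_of_bool _)%N.
exact: (same_connect_r sedge_conn_sym (connect1 sij)).
Qed.

Lemma same_class_swap w i j :
  e i j -> same_class (w + xy i j)%MM = same_class (w + xy j i)%MM.
Proof.
by move=> eij; apply/idP/idP; apply: same_class_swap_imp; rewrite // e_sym.
Qed.

(** The linear form that detects m: on the class of m it is the sign picked up
    by the token moves, elsewhere it is 0. *)
Definition weight w : K :=
  if same_class w then (-1) ^+ (\sum_(i | colour sedge i) w (yvar i))%N else 0.

(** Linear extension of the weight; a finite range of degrees suffices since
    the class of m is homogeneous. *)
Definition pairing (f : {mpoly K[n + n]}) : K :=
  \sum_(v : 'X_{1..(n + n) < (mdeg m).+1}) f@_v * weight v.

Lemma pairing0 : pairing 0 = 0.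
Proof. by rewrite /pairing big1 // => v _; rewrite mcoeff0 mul0r. Qed.

Lemma pairingD f g : pairing (f + g) = pairing f + pairing g.
Proof.
by rewrite -big_split /=; apply: eq_bigr => v _; rewrite mcoeffD mulrDl.
Qed.

Lemma pairingZ c f : pairing (c *: f) = c * pairing f.
Proof.
by rewrite mulr_sumr; apply: eq_bigr => v _; rewrite mcoeffZ mulrA.
Qed.

Lemma pairingX v : pairing 'X_[v] = weight v.
Proof.
have [lv|gv] := ltnP (mdeg v) (mdeg m).+1.
  rewrite /pairing (bigD1 (BMultinom lv)) //= mcoeffX eqxx mul1r.
  rewrite big1 ?addr0 // => w wv.
  rewrite mcoeffX; case: eqP => [vw|_]; last by rewrite mul0r.
  by case/eqP: wv; apply: val_inj; rewrite /= vw.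
have nc : ~~ same_class v.
  by apply: contraL gv => /same_class_mdeg ->; rewrite ltnn.
rewrite /weight (negbTE nc) /pairing big1 // => w _; rewrite mcoeffX.
by case: eqP => [vw|_]; rewrite ?mul0r // mul1r -vw /weight (negbTE nc).
Qed.

Hypothesis sorted_components : forall i j,
  connect sedge i j -> has_x m i -> has_y m j -> (j <= i)%N.

(** At the first difference w has fewer x_i, hence more y_i, than m; as the
    tokens of m in this component lie on labels at most i, w would have too
    many tokens. *)
Lemma lex_min_in_class w : same_class w -> lex_le w m -> w = m.
Proof.
case/same_classP=> deg sum /lex_le_cases[//|[t]].
rewrite -(splitK t); case: (split t) => i /= eq_lt lt_i; last first.
  have := eq_lt (xvar i).
  rewrite /= (leq_trans (ltn_ord i)) ?leq_addr // => /(_ isT).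
  by have := deg i; move: lt_i; rewrite /yvar; lia.
have xi : has_x m i by rewrite /has_x /xvar; lia.
have le_y k : connect sedge i k -> (m (yvar k) <= w (yvar k))%N.
  move=> ik; case: (ltngtP k i) => [ki|ki|/val_inj ->].
  - by have := eq_lt (xvar k) ki; have := deg k; rewrite /xvar; lia.
  - rewrite leqNgt; apply/negP=> /(leq_ltn_trans (leq0n _)) yk.
    by have := sorted_components ik xi yk; rewrite leqNgt ki.
  by have := deg i; move: lt_i; rewrite /xvar; lia.
have lt_y : (m (yvar i) < w (yvar i))%N.
  by have := deg i; move: lt_i; rewrite /xvar; lia.
move/eqP: (sum i); rewrite (bigD1 i) ?connect0 //=.
rewrite [X in _ == X](bigD1 i) ?connect0 //=.
by rewrite gtn_eqF // -addSn leq_add // leq_sum // => k /andP[/le_y].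
Qed.

Hypothesis pure_components : forall r a b,
  connect cover (r, false) (r, true) ->
  connect sedge r a -> connect sedge r b -> has_x m a -> has_y m b -> False.

Lemma positive_summand (P : pred 'I_n) (F : 'I_n -> nat) :
  (0 < \sum_(k | P k) F k)%N -> exists2 k, P k & (0 < F k)%N.
Proof.
rewrite lt0n sum_nat_eq0 negb_forall => /existsP[k].
rewrite negb_imply => /andP[Pk].
by rewrite -lt0n => Fk; exists k.
Qed.

(** If the ends of the edge have different colours the signs are opposite.
    Otherwise their component has an odd closed walk, so it should carry a
    single letter, whereas x_i and y_j occur together in the class of m. *)
Lemma weight_swap w i j :
  e i j -> weight (w + xy i j)%MM + weight (w + xy j i)%MM = 0.
Proof.
move=> eij; rewrite /weight -(same_class_swap w eij).
case: ifP => [cls|_]; last by rewrite addr0.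
have sij := same_class_supp_edge eij cls.
rewrite (sum_xy_y _ w i j) (sum_xy_y _ w j i) 2!exprD -mulrDr.
have [cij|cij] := eqVneq (colour sedge i) (colour sedge j); last first.
  by case: (colour sedge i) (colour sedge j) cij => [] [] // _;
    rewrite ?addrN ?addNr mulr0.
have odd_walk := monochromatic_edge (supp_edge_sym m e_sym) sij cij.
case/same_classP: cls => deg sum; set r := fingraph.root sedge i in odd_walk.
have ri : connect sedge r i by rewrite sedge_conn_sym connect_root.
have rj : connect sedge r j := connect_trans ri (connect1 sij).
have [b rb yb] : exists2 b, connect sedge r b & has_y m b.
  by apply: positive_summand; rewrite -sum sum_xy_y rj addn1.
have [a ra xa] : exists2 a, connect sedge r a & has_x m a.
  apply: positive_summand.
  rewrite -(ltn_add2r (\sum_(k | connect sedge r k) m (yvar k))%N).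
  rewrite add0n -big_split /= -[X in (X < _)%N]sum.
  under [X in (_ < X)%N]eq_bigr do rewrite -deg.
  rewrite big_split /= -[X in (X < _)%N]add0n ltn_add2r (bigD1 i) //=.
  by rewrite mnmDE xy_xE eqxx addn1.
by case: (pure_components odd_walk ra rb xa yb).
Qed.

Lemma pairing_ideal f : perm_edge_ideal e f -> pairing f = 0.
Proof.
case=> l [c [s [Ss ->]]]; elim/big_rec: _ => [|i g _ g0]; first exact: pairing0.
rewrite pairingD g0 addr0; case: (Ss i) => j [k [ejk ->]] {g g0 Ss s}.
elim/mpolyind: (c i) => [|a w p _ _ IHp]; first by rewrite mul0r pairing0.
rewrite mulrDl pairingD IHp addr0 -scalerAl pairingZ.
have -> : 'X_[w] * b_ K j k = 'X_[(w + xy j k)%MM] + 'X_[(w + xy k j)%MM].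
  by rewrite /b_ /x_ /y_ mulrDr -!mpolyXD.
by rewrite pairingD !pairingX weight_swap // mulr0.
Qed.

Lemma standard_not_lead (f : {mpoly K[n + n]}) :
  perm_edge_ideal e f -> is_lead (@lex_le (n + n)) f m -> False.
Proof.
move=> /pairing_ideal f0 [mf lead_m]; move: mf; rewrite mcoeff_msupp => /negP[].
move: f0; rewrite /pairing (bigD1 (BMultinom (ltnSn (mdeg m)))) //=.
rewrite big1 => [|v vm].
  rewrite addr0 /weight same_class_refl => /eqP.
  by rewrite mulf_eq0 signr_eq0 orbF.
have [/lead_m vle|] := boolP (bmnm v \in msupp f); last first.
  by rewrite -mcoeff_eq0 => /eqP ->; rewrite mul0r.
rewrite /weight; case: ifP => [cls|_]; last by rewrite mulr0.
by case/eqP: vm; apply: val_inj; rewrite /= (lex_min_in_class cls vle).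
Qed.

End StandardMonomials.

(** * Finiteness of the list *)

Section Finiteness.

Set Implicit Arguments.
Unset Strict Implicit.

Variables (n : nat) (K : fieldType) (e : rel 'I_n).

Lemma uniq_bseq (T : finType) (s : seq T) (N : nat) :
  uniq s -> (#|T| <= N)%N -> exists b : N.-bseq T, s = b.
Proof.
move=> us TN; have sN : (size s <= N)%N.
  by apply: leq_trans TN; rewrite -(card_uniqP us) max_card.
by exists (Bseq sN).
Qed.

Lemma path_bseq i j p : is_path e i j p -> exists b : n.-bseq 'I_n, p = b.
Proof.
by case/and4P=> _ _ _ /andP[_ up]; apply: uniq_bseq up _; rewrite card_ord.
Qed.

Lemma adm_bseq i j p : admissible e i j p -> exists b : n.-bseq 'I_n, p = b.
Proof. by case/andP=> /path_bseq. Qed.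

Lemma perm_edge_gb_finite :
  exists s : seq {mpoly K[n + n]}, forall f, perm_edge_gb e f <-> f \in s.
Proof.
(* The vertices of a path are distinct, so sequences of length at most n
   suffice. *)
pose I := 'I_n; pose B := n.-bseq 'I_n.
pose singles (A : I -> I -> seq I -> bool)
    (F : I -> I -> seq I -> {mpoly K[n + n]}) :=
  [seq F t.1.1 t.1.2 t.2
  | t : I * I * B in [pred t : I * I * B | A t.1.1 t.1.2 t.2]].
have singlesP (A : I -> I -> seq I -> bool)
    (F : I -> I -> seq I -> {mpoly K[n + n]}) f :
    reflect (exists i j (p : B), A i j p /\ f = F i j p) (f \in singles A F).
  apply: (iffP imageP) => [[[[i j] p] Ap ->]|[i [j [p [Ap ->]]]]].
    by exists i, j, p.
  by exists (i, j, p).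
pose pairs :=
  [seq let: (i, j, p, q) := t in
       'X_[mlcm (u_ i j p) (u_ i j q)] * (y_ K i * x_ K j)
  | t : I * I * B * B in [pred t : I * I * B * B |
      let: (i, j, p, q) := t in odd_adm e i j p && even_adm e i j q]].
have pairsP f : reflect (exists i j (p q : B),
    [/\ odd_adm e i j p, even_adm e i j q
      & f = 'X_[mlcm (u_ i j p) (u_ i j q)] * (y_ K i * x_ K j)])
    (f \in pairs).
  apply: (iffP imageP) => [[[[[i j] p] q] /= /andP[op oq] ->]|].
    by exists i, j, p, q.
  by case=> i [j [p [q [op oq ->]]]]; exists (i, j, p, q) => //; apply/andP.
pose tails (lt : rel nat) (X Y : I -> {mpoly K[n + n]}) :=
  [seq let: (i, j, p, q, a, c, t) := d in Y c * \prod_(h in W_ i p q a t c) X h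
  | d : I * I * B * B * I * I * B in [pred d : I * I * B * B * I * I * B |
      let: (i, j, p, q, a, c, t) := d in
      [&& odd_adm e i j p, even_adm e i j q, tail_path e i p q a c t
        & [forall h in W_ i p q a t c, lt c h]]]].
have tailsP (lt : rel nat) (X Y : I -> {mpoly K[n + n]}) f :
    reflect (exists i j (p q : B) a c (t : B),
    [/\ odd_adm e i j p, even_adm e i j q, tail_path e i p q a c t,
      forall h, h \in W_ i p q a t c -> lt c h
      & f = Y c * \prod_(h in W_ i p q a t c) X h])
    (f \in tails lt X Y).
  apply: (iffP imageP) => [[[[[[[[i j] p] q] a] c] t]]|].
    by case/and4P=> op oq tp /forall_inP cW ->; exists i, j, p, q, a, c, t.
  case=> i [j [p [q [a [c [t [op oq tp cW ->]]]]]]].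
  exists (i, j, p, q, a, c, t) => //; apply/and4P; split=> //.
  exact/forall_inP.
have odd_bseq i j p : odd_adm e i j p -> exists b : B, p = b.
  by case/andP=> /adm_bseq.
have even_bseq i j p : even_adm e i j p -> exists b : B, p = b.
  by case/andP=> /adm_bseq.
exists (singles (odd_adm e) (fun i j p => 'X_[u_ i j p] * b_ K i j)
  ++ singles (even_adm e) (fun i j p => 'X_[u_ i j p] * g_ K i j)
  ++ pairs ++ tails ltn (x_ K) (y_ K) ++ tails gtn (y_ K) (x_ K)).
move=> f; rewrite !mem_cat; split.
  case=> {f} [i j p op|i j p op|i j p q op oq|i j p q a c t op oq tp cW
      |i j p q a c t op oq tp cW].
  - have [b pb] := odd_bseq _ _ _ op; rewrite {p}pb in op *.
    by apply/orP; left; apply/singlesP; exists i, j, b.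
  - have [b pb] := even_bseq _ _ _ op; rewrite {p}pb in op *.
    by apply/or3P/Or32/singlesP; exists i, j, b.
  - have [b pb] := odd_bseq _ _ _ op; rewrite {p}pb in op *.
    have [d qd] := even_bseq _ _ _ oq; rewrite {q}qd in oq *.
    by apply/or4P/Or43/pairsP; exists i, j, b, d.
  - have [b pb] := odd_bseq _ _ _ op; rewrite {p}pb in op tp cW *.
    have [d qd] := even_bseq _ _ _ oq; rewrite {q}qd in oq tp cW *.
    have [r tr] : exists r : B, t = r by apply: (path_bseq (proj1 (andP tp))).
    rewrite {t}tr in tp cW *.
    apply/or4P/Or44/orP; left; apply/(tailsP ltn).
    by exists i, j, b, d, a, c, r.
  have [b pb] := odd_bseq _ _ _ op; rewrite {p}pb in op tp cW *.
  have [d qd] := even_bseq _ _ _ oq; rewrite {q}qd in oq tp cW *.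
  have [r tr] : exists r : B, t = r by apply: (path_bseq (proj1 (andP tp))).
  rewrite {t}tr in tp cW *.
  apply/or4P/Or44/orP; right; apply/(tailsP gtn).
  by exists i, j, b, d, a, c, r.
case/or4P=> [/singlesP[i [j [p [op ->]]]]|/singlesP[i [j [p [op ->]]]]
    |/pairsP[i [j [p [q [op oq ->]]]]]|].
- exact: gb_odd.
- exact: gb_even.
- exact: gb_lcm.
by case/orP=> /tailsP[i [j [p [q [a [c [t [op oq tp cW ->]]]]]]]];
  [exact: gb_low op oq tp cW | exact: gb_high op oq tp cW].
Qed.

End Finiteness.

(** * The Groebner basis *)

Theorem theorem3p2 (n : nat) (K : fieldType) (e : rel 'I_n)
    (e_sym : symmetric e) (e_irr : irreflexive e)
    (charK : 2%N \notin [pchar K]) :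
  groebner_basis (@lex_le (n + n)) (@perm_edge_gb n K e)
    (@perm_edge_ideal n K e).
Proof.
have gb_sub f : perm_edge_gb e f -> perm_edge_ideal (K := K) e f.
  exact: perm_edge_gb_mem.
split=> // [|t]; first exact: perm_edge_gb_finite.
split.
  apply: ideal_gen_sub => _ [f [u [Sf lf ->]]]; apply: ideal_gen_mem.
  by exists f, u; split=> //; apply: gb_sub.
apply: ideal_gen_sub => _ [f [m [If lf ->]]].
suff [g [u [Sg lg um]]] : gb_divides K e m.
  rewrite -(submK um) mpolyXD; apply: ideal_genM; apply: ideal_gen_mem.
  by exists g, u.
pose r := supp_edge e m.
have r_csym : connect_sym r by apply: sym_connect_sym; apply: supp_edge_sym.
have [/'exists_existsP[i [j /and4P[ij xi yj /connectP[p pp pj]]]]|sorted] :=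
    boolP [exists i : 'I_n, exists j : 'I_n,
      [&& (i < j)%N, has_x m i, has_y m j & connect r i j]].
  exact: (inversion_divides K ij xi yj pp (esym pj)).
have {}sorted i j : connect r i j -> has_x m i -> has_y m j -> (j <= i)%N.
  move=> cij xi yj; rewrite leqNgt; apply: contra sorted => ij.
  by apply/'exists_existsP; exists i, j; rewrite ij xi yj.
have [/existsP[i /existsP[a /existsP[b /and5P[]]]]|pure] :=
    boolP [exists i, exists a, exists b,
      [&& connect (parity_cover r) (i, false) (i, true), connect r i a,
        connect r i b, has_x m a & has_y m b]].
  case/parity_coverP=> p [pp lp op] ca cb xa yb.
  apply: (odd_component_divides _ e_sym e_irr _ pp lp op ca cb xa yb).
  move=> k l ck cl; apply: sorted; apply: connect_trans cl.
  by rewrite r_csym.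
case: (standard_not_lead e_sym sorted _ If lf) => i a b walk ca cb xa yb.
case/negP: pure; apply/existsP; exists i; apply/existsP; exists a.
by apply/existsP; exists b; rewrite walk ca cb xa yb.
Qed.
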